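(* Let $\theta>0$ and let $\mathcal{L}$ be the uniform distribution on the unit circle. The 1-correlation measures $\tilde\tau_N^{[1]}$ ($N\ge1$) and $\tilde\tau_\infty^{[1]}$ are equal to Lebesgue measure on $\mathbb{R}$.
   Context: $\Sigma_N$ is the group of permutations of $\{1,\dots,N\}$. For $\sigma\in\Sigma_N$ and $z_1,\dots,z_N\in\mathbb{C}^*$, $M(\sigma,z_1,\dots,z_N)$ is the $N\times N$ matrix $M$ with entries $M_{jk}=z_j\mathbf{1}_{j=\sigma(k)}$. $\mathbb{P}(N,\theta,\mathcal{L})$ is the law of $M(\sigma,z_1,\dots,z_N)$ where $\sigma$ follows the Ewens measure of parameter $\theta$ on $\Sigma_N$ (each permutation has probability proportional to $\theta^n$, $n$ its number of cycles), $z_1,\dots,z_N$ have law $\mathcal{L}$, and $\sigma,z_1,\dots,z_N$ are independent. For $M_N\sim\mathbb{P}(N,\theta,\mathcal{L})$, $\tau_N(M_N)$ is the point measure on $\mathbb{R}$ $$\tau_N(M_N)=\sum_{x\in\mathbb{R}:\ e^{2i\pi x/N}\text{ eigenvalue of }M_N}m(x)\,\delta_x,$$ where $m(x)$ is the multiplicity of the eigenvalue $e^{2i\pi x/N}$ of $M_N$. For $\mathcal{L}$ uniform on the unit circle, $\tau_\infty(\theta,\mathcal{L})=\sum_{m=1}^\infty\sum_{k\in\mathbb{Z}}\delta_{(k+\chi_m)/x_m}$, where $(x_m)_{m\ge1}$ is a Poisson-Dirichlet process of parameter $\theta$ and $(\chi_m)_{m\ge1}$ is an independent sequence of i.i.d.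 uniform random variables on $[0,1)$. (A Poisson-Dirichlet process of parameter $\theta$ has the law of the decreasing rearrangement of the GEM($\theta$) sequence $y_m=V_m\prod_{i<m}(1-V_i)$, with $(V_i)$ i.i.d. of density $\theta(1-x)^{\theta-1}$ on $(0,1)$.) The 1-correlation measures are the expectations: $\tilde\tau_N^{[1]}(A)=\mathbb{E}[\tau_N(M_N)(A)]$ and $\tilde\tau_\infty^{[1]}(A)=\mathbb{E}[\tau_\infty(\theta,\mathcal{L})(A)]$ for Borel $A\subset\mathbb{R}$. *)

(* Defs.v *)
From HB Require Import structures.
From mathcomp Require Import all_boot all_order all_algebra all_fingroup.
From mathcomp Require Import finmap complex.
From mathcomp Require Import all_classical all_reals all_analysis.
From mathcomp Require Import measurable_realfun.

Set Implicit Arguments.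
Unset Strict Implicit.
Unset Printing Implicit Defensive.
Import Order.TTheory GRing.Theory Num.Theory.
Import numFieldNormedType.Exports.
Local Open Scope classical_set_scope.
Local Open Scope ring_scope.

(* The Borel sigma-algebra of C = R^2, generated by the real and imaginary
   parts. *)
Definition complex_display : measure_display.
Proof. exact: default_measure_display. Qed.

Section complex_measurable.
Variable R : realType.

HB.instance Definition _ := isPointed.Build R[i] 0.

Definition complex_measurable : set (set R[i]) :=
  g_sigma_preimageU (@complex.Re R) (@complex.Im R).

Let complex_measurable0 : complex_measurable set0.
Proof. exact: sigma_algebra0. Qed.

Let complex_measurableC (A : set R[i]) :
  complex_measurable A -> complex_measurable (~` A).
Proof. exact: sigma_algebraC. Qed.

Let complex_measurable_bigcup (F : (set R[i])^nat) :
  (forall i, complex_measurable (F i)) -> complex_measurable (\bigcup_i F i).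
Proof. exact: sigma_algebra_bigcup. Qed.

HB.instance Definition _ := @isMeasurable.Build complex_display R[i]
  complex_measurable complex_measurable0 complex_measurableC
  complex_measurable_bigcup.
End complex_measurable.

HB.instance Definition _ (T : finType) :=
  isPointed.Build (perm_type T) (1%g : {perm T}).
HB.instance Definition _ (T : finType) :=
  @isMeasurable.Build default_measure_display (perm_type T) discrete_measurable
    discrete_measurable0 discrete_measurableC discrete_measurableU.

(* The space of real sequences with the product sigma-algebra. *)
Definition seq_cylinders (R : realType) : set (set (nat -> R)) :=
  \bigcup_n preimage_set_system setT (fun u : nat -> R => u n) measurable.
Notation realseq R := (g_sigma_algebraType (@seq_cylinders R)).

Section random_variables.
Context d (T : measurableType d) (R : realType) (P : probability T R).

(* For a measure given as a set function, only measurable sets matter. *)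
Definition has_law d' (T' : measurableType d') (X : {RV P >-> T'})
    (mu : set T' -> \bar R) : Prop :=
  forall A, measurable A -> distribution P X A = mu A.

Definition mutually_independent (I : choiceType) (G : I -> set (set T)) :
    Prop :=
  forall (J : {fset I}) (E : I -> set T), (forall i, i \in J -> G i (E i)) ->
    P (\bigcap_(i in [set` J]) E i) = (\prod_(i <- J) P (E i))%E.

End random_variables.

Section permutation_matrices.
Variable R : realType.

Definition expi (t : R) : R[i] := Complex (cos t) (sin t).

Definition circle_param (u : measurableTypeR R) : R[i] := expi (2 * pi * u).

Lemma measurable_circle_param : measurable_fun setT circle_param.
Proof.
have mlin : measurable_fun setT (fun u : R => 2 * pi * u).
  exact: measurable_funM.
apply: (@measurability _ _ _ _ setT circle_param) => //.
move=> _ [_ [[B mB <-]|[B mB <-]] <-]; rewrite !setTI.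
- rewrite -comp_preimage -[X in measurable X]setTI.
  have mf : measurable_fun setT (@cos R \o (fun u : R => 2 * pi * u)).
    apply: measurableT_comp => //; apply: continuous_measurable_fun.
    exact: continuous_cos.
  exact: mf.
- rewrite -comp_preimage -[X in measurable X]setTI.
  have mf : measurable_fun setT (@sin R \o (fun u : R => 2 * pi * u)).
    apply: measurableT_comp => //; apply: continuous_measurable_fun.
    exact: continuous_sin.
  exact: mf.
Qed.

HB.instance Definition _ :=
  isMeasurableFun.Build _ _ _ _ circle_param measurable_circle_param.

Definition uniform_circle : probability R[i] R :=
  distribution (uniform_prob (@ltr01 R))
    (circle_param : {mfun measurableTypeR R >-> R[i]}).

Definition ewens (N : nat) (theta : R) (A : set 'S_N) : \bar R :=
  ((\sum_(s : 'S_N | s \in A) theta ^+ #|porbits s|) /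
   (\sum_(s : 'S_N) theta ^+ #|porbits s|))%:E.

Definition Mmx (N : nat) (s : 'S_N) (z : 'I_N -> R[i]) : 'M[R[i]]_N :=
  \matrix_(j, k) (if j == s k then z j else 0).

(* Under this hypothesis the random matrix w |-> Mmx (sigma w) (z ^~ w) has
   law P(N, theta, L). *)
Definition Mmx_data (theta : R) (L : probability R[i] R) (N : nat)
    d (T : measurableType d) (P : probability T R)
    (sigma : {RV P >-> 'S_N}) (z : 'I_N -> {RV P >-> R[i]}) : Prop :=
  [/\ has_law sigma (ewens theta),
      forall j, has_law (z j) L &
      mutually_independent P
        (oapp (fun j => g_sigma_algebra_preimage (z j))
              (g_sigma_algebra_preimage sigma))].

(* The multiplicities are algebraic; they are also the geometric ones when the
   z_j are nonzero, as Mmx s z is then diagonalizable. *)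
Definition tauN (N : nat) (M : 'M[R[i]]_N) (A : set R) : \bar R :=
  (\esum_(x in [set x : R | eigenvalue M (expi (2 * pi * x / N%:R))])
    ((mup (expi (2 * pi * x / N%:R)) (char_poly M))%:R%:E * \d_x A))%E.

End permutation_matrices.

Section limit_process.
Variable R : realType.

(* y_m = V_m prod_(i < m) (1 - V_i), indexed from 0: the GEM(theta) sequence
   when the V_i are i.i.d. of law Beta(1, theta). *)
Definition stick_breaking (V : nat -> R) (m : nat) : R :=
  V m * \prod_(i < m) (1 - V i).

Definition decreasing_rearrangement (y x : nat -> R) : Prop :=
  nonincreasing_seq x /\ exists2 f : nat -> nat, bijective f & x = y \o f.

Definition beta1 (theta : R) (A : set R) : \bar R :=
  (\int[lebesgue_measure]_(t in A `&` `]0%R, 1%R[)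
    (theta * (1 - t) `^ (theta - 1))%:E)%E.

Definition poisson_dirichlet (theta : R) d (T : measurableType d)
    (P : probability T R) (x : {RV P >-> realseq R}) : Prop :=
  exists (d' : measure_display) (T' : measurableType d')
    (P' : probability T' R) (V : nat -> {RV P' >-> R})
    (x' : {RV P' >-> realseq R}),
  [/\ forall i, has_law (V i) (beta1 theta),
      mutually_independent P' (fun i => g_sigma_algebra_preimage (V i)),
      {ae P', forall w,
        decreasing_rearrangement (stick_breaking (V ^~ w)) (x' w)} &
      has_law x (distribution P' x')].

Definition tau_infty (x chi : nat -> R) (A : set R) : \bar R :=
  (\sum_(0 <= m <oo)
    \esum_(k in [set: int]) \d_((k%:~R + chi m) / x m)%R A)%E.

Definition tau_infty_data (theta : R) d (T : measurableType d)
    (P : probability T R) (x : {RV P >-> realseq R})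
    (chi : nat -> {RV P >-> R}) : Prop :=
  [/\ poisson_dirichlet theta x,
      (* The law on [0, 1] and on [0, 1[ is the same. *)
      forall m, has_law (chi m) (uniform_prob (@ltr01 R)) &
      mutually_independent P
        (oapp (fun m => g_sigma_algebra_preimage (chi m))
              (g_sigma_algebra_preimage x))].

End limit_process.

Definition correlation1 d (T : measurableType d) (R : realType)
    (P : probability T R) (tau : T -> set R -> \bar R) (A : set R) : \bar R :=
  (\int[P]_w tau w A)%E.

(* Main.v *)
Require Import Defs.
From HB Require Import structures.
From mathcomp Require Import all_boot all_order all_algebra all_fingroup.
From mathcomp Require Import finmap complex.
From mathcomp Require Import all_classical all_reals all_analysis.
From mathcomp Require Import measurable_realfun ring lra.

Set Implicit Arguments.
Unset Strict Implicit.
Unset Printing Implicit Defensive.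
Import Order.TTheory GRing.Theory Num.Theory.
Import numFieldNormedType.Exports.
Local Open Scope classical_set_scope.
Local Open Scope ring_scope.

(** Both measures are computed by averaging over a uniform phase.  The basic
    object is [grid_count x b A], the number of points of the lattice
    (Z + b) / x that lie in A.  When b is replaced by u + b with u uniform on
    [0, 1], every unit interval of the lattice parameter is swept exactly once,
    so the mean count is the Lebesgue measure of x A, that is x times the
    measure of A ([integral_grid_count]).

    The limit process.  Conditionally on the masses x_m, the independent phase
    chi_m makes the m-th lattice contribute x_m |A| on average, by Fubini for
    independent variables ([independent_fubini]).  The total is |A| times the
    sum of the masses, and the masses of a Poisson-Dirichlet process are almost
    surely positive with sum 1.  The sum is 1 because the length left after n
    breaks is the product of the 1 - V_i, i < n, and by independence infinitely
    many V_i exceed a fixed positive level ([independent_infinitely_often],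
    [stick_breaking_sum1]).

    Finite N.  When the z_j have modulus 1, so do all eigenvalues
    e(y_1), ..., e(y_N) of the matrix, with e(t) = exp(2 i pi t), and tau_N is
    the sum of the counts of the lattices N (Z + y_i) ([tauN_grid_count]).
    Multiplying all z_j by e(t) preserves their joint law with sigma
    ([rotated_data_law]) and replaces every y_i by y_i + t ([char_poly_scale]).
    So the mean of tau_N can also be averaged over t in [0, 1]; exchanging the
    two integrals, the inner one is a sum of N terms |A| / N, whatever the y_i
    are.

    Fubini requires the eigenangles y_i to be measurable functions of the data.
    They are chosen one at a time: the least angle at which the characteristic
    polynomial vanishes is measurable ([measurable_least_zero]), dividing by the
    corresponding linear factor keeps the coefficients measurable, and the
    degree drops ([measurable_circle_roots]). *)

(** The measure structure of the image of a measure by a map that is given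
    together with a proof of its measurability. *)
Definition pushforward_measure d1 d2 (T1 : measurableType d1)
    (T2 : measurableType d2) (R : realType) (m : {measure set T1 -> \bar R})
    (f : T1 -> T2) (mf : measurable_fun setT f) : {measure set T2 -> \bar R} :=
  measure_function_pushforward__canonical__measure_function_Measure m mf.

(** * Counting the points of a shifted lattice *)

Section grid.
Variable R : realType.
Local Notation mu := (@lebesgue_measure R).

(** Both sides, divided by x, are measures in A that agree on half-open
    intervals, which determines Lebesgue measure. *)
Lemma lebesgue_measure_affine (x b : R) (A : set R) : 0 < x -> measurable A ->
  mu ((fun v => (v + b) / x) @^-1` A) = (x%:E * mu A)%E.
Proof.
move=> x0 mA.
have x0' : 0 <= x^-1 by rewrite invr_ge0 ltW.
have mf : measurable_fun setT
  (fun v : measurableTypeR R => (v + b) / x : measurableTypeR R).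
  by apply: measurable_funM => //; exact: measurable_funD.
pose push := pushforward_measure mu mf.
pose nu := mscale (NngNum x0') push.
have -> : mu A = nu A.
  apply: lebesgue_measure_unique => //= _ [[c d]] _ <-.
  have E : (fun v => (v + b) / x) @^-1` `]c, d] = `](c * x - b),
    (d * x - b)]%classic.
    by apply/seteqP; split => v /=;
      rewrite !in_itv/= ltr_pdivlMr// ler_pdivrMr// ltrBlDr lerBrDr.
  transitivity ((x^-1)%:E * mu ((fun v : R => (v + b) / x)%R @^-1` `]c, d]))%E;
    last by [].
  rewrite E !lebesgue_measure_itv/= !lte_fin ltrD2r ltr_pM2r//.
  case: ifPn => _; last by rewrite mule0.
  rewrite -!EFinB -EFinM; congr EFin.
  rewrite opprB addrA subrK -mulrBl mulrCA mulVf ?mulr1// gt_eqF//.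
transitivity (x%:E * ((x^-1)%:E * mu ((fun v : R => (v + b) / x)%R @^-1` A)))%E;
  last by [].
rewrite muleA -EFinM mulfV ?mul1e//.
by rewrite gt_eqF.
Qed.

(** Enumerates the integers along nat, so that sums over the integers become
    series, which commute with integrals of nonnegative functions. *)
Definition int_of_parity (n : nat) : int :=
  if odd n then Negz n./2 else Posz n./2.

Lemma int_of_parity_bij : set_bij [set: nat] [set: int] int_of_parity.
Proof.
split => //.
- move=> m n _ _; rewrite /int_of_parity.
  case om: (odd m); case on: (odd n) => // -[e];
    by rewrite -(odd_double_half m) -(odd_double_half n) om on e.
- move=> [n|n] _; [exists n.*2|exists n.*2.+1] => //; rewrite /int_of_parity/=.
    by rewrite odd_double doubleK.
  by rewrite odd_double/= uphalf_double.
Qed.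

Definition grid_count (x b : R) (A : set R) : \bar R :=
  (\esum_(k in [set: int]) \d_((k%:~R + b) / x)%R A)%E.

Lemma grid_countE (x b : R) (A : set R) : grid_count x b A =
  (\sum_(0 <= n <oo) (\1_A (((int_of_parity n)%:~R + b) / x)%R)%:E)%E.
Proof.
rewrite /grid_count (reindex_esum _ _ _ _ int_of_parity_bij) nneseries_esumT//.
Qed.

Lemma grid_count_ge0 x b A : (0 <= grid_count x b A)%E.
Proof. by apply: esum_ge0. Qed.

Lemma measurable_inv : measurable_fun setT (@GRing.inv R).
Proof.
have -> : [set: R] = [set 0] `|` ~` [set 0] by rewrite setUv.
apply/measurable_funU => //; first exact: measurableC.
split; first exact: measurable_fun_set1.
apply: open_continuous_measurable_fun.
  apply/closed_openC/accessible_closed_set1.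
  exact/hausdorff_accessible/Rhausdorff.
by move=> x /set_mem/eqP x0; exact: inv_continuous.
Qed.

Lemma measurable_grid_term d (T : measurableType d) (f g : T -> R) A (k : int) :
  measurable A -> measurable_fun setT f -> measurable_fun setT g ->
  measurable_fun setT (fun t => (\1_A ((k%:~R + g t) / f t)%R : R)%:E).
Proof.
move=> mA mf mg; apply/measurable_EFinP.
have mh : measurable_fun setT (fun t => (k%:~R + g t) / f t).
  apply: measurable_funM; first exact: measurable_funD.
  exact: (measurableT_comp measurable_inv).
have mI : measurable_fun setT (\1_A : measurableTypeR R -> R).
  exact: measurable_indic.
exact: (measurableT_comp mI mh).
Qed.

Lemma measurable_grid_count d (T : measurableType d) (f g : T -> R) A :
  measurable A -> measurable_fun setT f -> measurable_fun setT g ->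
  measurable_fun setT (fun t => grid_count (f t) (g t) A).
Proof.
move=> mA mf mg.
under eq_fun do rewrite grid_countE.
apply: ge0_emeasurable_sum => [k t _ _|k _]; first by rewrite lee_fin.
exact: measurable_grid_term.
Qed.

(** As u runs over [0, 1], k + u runs over [k, k + 1]; summing over k integrates
    the indicator of the set of v with (v + b) / x in A over the whole line. *)
Lemma integral_grid_count (x b : R) (A : set R) : 0 < x -> measurable A ->
  (\int[mu]_(u in `[0%R, 1%R]) grid_count x (u + b) A = x%:E * mu A)%E.
Proof.
move=> x0 mA.
pose B := (fun v : R => (v + b) / x) @^-1` A.
have mf : measurable_fun setT (fun v : R => (v + b) / x).
  by apply: measurable_funM => //; exact: measurable_funD.
have mB : measurable B by rewrite -[B]setTI; exact: mf.
rewrite -(lebesgue_measure_affine b x0 mA) -/B.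
(* The pieces of B in the unit intervals that k + u sweeps. *)
pose C (k : int) := B `&` `[k%:~R, k%:~R + 1[%classic.
have mC k : measurable (C k) by apply: measurableI.
have -> : B = \bigcup_n C (int_of_parity n).
  rewrite -setI_bigcupr; apply/esym/setIidPl => v _.
  have [_ _ /(_ (Num.floor v) I)[n _ nv]] := int_of_parity_bij.
  exists n => //=; rewrite in_itv/= nv.
  by rewrite floor_le/= -[1]/(1%:~R) -intrD floorD1_gt.
rewrite measure_bigcup; last first.
  apply/trivIsetP => m n _ _ mn; apply/seteqP; split => // v [[_]] + [_].
  rewrite /= !in_itv/= => /andP[m1 m2] /andP[n1 n2].
  have [_ i _] := int_of_parity_bij.
  move/eqP : mn; apply; apply: i; rewrite ?inE//.
  have := le_lt_trans m1 n2; have := le_lt_trans n1 m2.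
  rewrite -[1]/(1%:~R) -!intrD !ltr_int !ltzD1 => h1 h2.
  by apply/eqP; rewrite eq_le h1 h2.
  by move=> n _; exact: mC.
rewrite (eq_eseriesl (Q := xpredT)); last by move=> n; apply/mem_set.
under eq_integral do rewrite grid_countE.
rewrite integral_nneseries//=; last first.
  move=> n; apply: measurable_funTS.
  by apply: measurable_grid_term => //; exact: measurable_funD.
apply: eq_eseriesr => n _.
set k := int_of_parity n.
rewrite -integral_itv_bndo_bndc; last first.
  apply: measurable_funTS.
  by apply: measurable_grid_term => //; exact: measurable_funD.
have -> : (fun u => (\1_A ((k%:~R + (u + b)) / x))%:E) =
  (fun u => (\1_((fun v => (v + k%:~R) / 1) @^-1` B) u)%:E) :> (R -> \bar R).
  by apply/funext => u; rewrite addrA (addrC _ u) -[in LHS](divr1 (u + _)).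
have mk : measurable_fun setT (fun v : R => (v + k%:~R) / 1).
  by apply: measurable_funM => //; exact: measurable_funD.
rewrite integral_indic//; last by rewrite -[X in measurable X]setTI; exact: mk.
rewrite -[RHS]mul1e -(lebesgue_measure_affine k%:~R ltr01 (mC k)).
congr (mu _); apply/seteqP; split => u /=; rewrite /C /= !in_itv/= !divr1.
  by move=> [Bu u01]; split=> //; rewrite lerDr addrC ltrD2l.
by move=> [Bu u01]; split=> //; move: u01; rewrite lerDr addrC ltrD2l.
Qed.
End grid.

(** * Exhausting a stick by stick breaking *)

Section stick_breaking.
Variable R : realType.
Implicit Type V : nat -> R.

Lemma sum_stick_breaking V n :
  \sum_(m < n) stick_breaking V m = 1 - \prod_(i < n) (1 - V i).
Proof.
elim: n => [|n IH]; first by rewrite !big_ord0 subrr.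
rewrite big_ord_recr/= IH big_ord_recr/= /stick_breaking; ring.
Qed.

(** Each index with e <= V i multiplies the remaining length by at most 1 - e,
    and there are infinitely many of them, so nothing remains in the limit. *)
Lemma stick_breaking_sum1 V (e : R) : 0 < e ->
  (forall i, 0 < V i < 1) ->
  (forall N, exists2 i, (N <= i)%N & e <= V i) ->
  (\sum_(0 <= m <oo) (stick_breaking V m)%:E = 1)%E.
Proof.
move=> e0 V01 Vio.
pose Q n := \prod_(i < n) (1 - V i).
have Q0 n : 0 <= Q n.
  by apply: prodr_ge0 => i _; rewrite subr_ge0 ltW//; case/andP : (V01 i).
have Qdec n k : Q (n + k)%N <= Q n.
  elim: k => [|k IH]; first by rewrite addn0.
  apply: le_trans IH; rewrite addnS /Q big_ord_recr/= ler_piMr//.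
    exact: Q0.
  by rewrite gerBl ltW//; case/andP : (V01 (n + k)%N).
have e1 : e < 1.
  have [i _ ei] := Vio 0%N; apply: (le_lt_trans ei); by case/andP : (V01 i).
(* Each passage above the level e contributes a factor at most 1 - e. *)
have Qe k : exists n, Q n <= (1 - e) ^+ k.
  elim: k => [|k [n IH]]; first by exists 0%N; rewrite /Q big_ord0 expr0.
  have [i ni ei] := Vio n; exists i.+1.
  rewrite /Q big_ord_recr/= exprSr ler_pM//; first exact: Q0.
  - by rewrite subr_ge0 ltW//; case/andP : (V01 i).
  - by apply: (le_trans _ IH); rewrite -(subnKC ni); exact: Qdec.
  - by rewrite lerD2l lerN2.
have Qcvg : Q @ \oo --> (0 : R).
  apply/cvgrPdist_le => d d0.
  have := @cvg_expr R (1 - e).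
  rewrite ger0_norm ?subr_ge0 ?ltW// gtrBl => /(_ e0)/cvgrPdist_le/(_ _ d0).
  case=> k _ /(_ k (leqnn _)); rewrite sub0r normrN => hk.
  have [n Qn] := Qe k.
  exists n => // m /= nm; rewrite sub0r normrN ger0_norm//.
  rewrite -(subnKC nm) (le_trans (Qdec _ _))// (le_trans Qn)//.
  by rewrite (le_trans _ hk)// ler_norm.
apply/cvg_lim => //.
have -> : (fun n => \sum_(0 <= m < n) (stick_breaking V m)%:E)%E =
    EFin \o (fun n => 1 - Q n).
  by apply/funext => n/=; rewrite sumEFin big_mkord sum_stick_breaking.
apply: cvg_EFin; first by near=> n.
rewrite -[X in _ --> X]subr0; apply: cvgB => //; exact: cvg_cst.
Unshelve. all: by end_near. Qed.

End stick_breaking.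

(** * Levels exceeded infinitely often by independent variables *)

Section infinitely_often.
Context d (T : measurableType d) (R : realType) (P : probability T R).

(** Otherwise X would be almost surely smaller than every 1 / n, hence not
    positive. *)
Lemma probability_lt_lt1 (X : {RV P >-> R}) :
  P (X @^-1` [set r | 0 < r]) = 1%E ->
  exists2 e : R, 0 < e & (P (X @^-1` [set r | (r < e)%R]) < 1)%E.
Proof.
move=> X1.
have mX e : measurable (X @^-1` [set r | (r < e)%R]).
  by rewrite -[X in measurable X]setTI; apply: measurable_funP => //;
    rewrite -set_itvNyo.
have mX' e : measurable (X @^-1` [set r | (e <= r)%R]).
  by rewrite -[X in measurable X]setTI; apply: measurable_funP => //;
    rewrite -set_itvcy.
apply/not_exists2P => H.
suff : P (X @^-1` [set r | 0 < r]) = 0%E by rewrite X1 => -[] /eqP;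
  rewrite oner_eq0.
have -> : X @^-1` [set r | 0 < r] =
  \bigcup_n X @^-1` [set r | (n.+1%:R^-1 <= r)%R].
  apply/seteqP; split => [w /= Xw|w [n _] /=].
    have [n _ /(_ n (leqnn _))/= hn] := near_infty_natSinv_lt (PosNum Xw).
    by exists n => //=; apply/ltW.
  by apply: lt_le_trans; rewrite invr_gt0.
apply: measure_negligible; first by apply: bigcupT_measurable.
apply: negligible_bigcup => n; apply/negligibleP; first exact: mX'.
have := H n.+1%:R^-1.
case => [|/negP]; first by rewrite invr_gt0 ltr0n.
rewrite -leNgt => h.
have -> : X @^-1` [set r | (n.+1%:R^-1 <= r)%R] =
  ~` (X @^-1` [set r | (r < n.+1%:R^-1)%R]).
  by apply/seteqP; split => w /=; rewrite leNgt => /negP.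
apply: (etrans (probability_setC P (mX n.+1%:R^-1))).
have -> : P (X @^-1` [set r | (r < n.+1%:R^-1)%R]) = 1%E.
  by apply/eqP; rewrite eq_le h andbT probability_le1.
by rewrite subee.
Qed.

(** If P (V i < e) = q < 1 for all i, then V N, ..., V (N + k - 1) are all
    below e with probability q ^ k, which tends to 0. *)
Lemma independent_infinitely_often (V : nat -> {RV P >-> R}) (e : R) :
  mutually_independent P (fun i => g_sigma_algebra_preimage (V i)) ->
  (forall i, P (V i @^-1` [set r | (r < e)%R]) =
    P (V 0%N @^-1` [set r | (r < e)%R])) ->
  (P (V 0%N @^-1` [set r | (r < e)%R]) < 1)%E ->
  {ae P, forall w, forall N, exists2 i, (N <= i)%N & e <= V i w}.
Proof.
move=> indV idV q1.
have mV i : measurable (V i @^-1` [set r | (r < e)%R]).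
  by rewrite -[X in measurable X]setTI; apply: measurable_funP => //;
    rewrite -set_itvNyo.
apply: ae_foralln => N.
pose E := \bigcap_k V (N + k)%N @^-1` [set r | (r < e)%R].
have mE : measurable E by apply: bigcapT_measurable.
exists E; split => //; last first.
  move=> w /= /forall2NP H k _ /=.
  have := H (N + k)%N; rewrite leq_addr => -[//|].
  by move/negP; rewrite -ltNge.
have [q qE] : exists q, P (V 0%N @^-1` [set r | (r < e)%R]) = q%:E.
  by exists (fine (P (V 0%N @^-1` [set r | (r < e)%R])));
    rewrite fineK// fin_num_measure.
have q0 : 0 <= q by rewrite -lee_fin -qE.
move: q1; rewrite qE lte_fin => q1.
have Eq k : (P E <= (q ^+ k)%:E)%E.
  have -> : (q ^+ k)%:E = P
    (\bigcap_(i in [set` [fset i | i in iota N k]%fset]) V i @^-1`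
    [set r | (r < e)%R]).
    rewrite indV; last by move=> i _; exists [set r | (r < e)%R];
      rewrite ?setTI// -set_itvNyo.
    under eq_bigr do rewrite idV qE.
    rewrite prodEFin big_const_seq count_predT -Monoid.iteropE.
    congr (q ^+ _)%:E; apply/esym.
    by rewrite [LHS]card_fseq undup_id ?iota_uniq// size_iota.
  apply: le_measure; rewrite ?inE//.
    by apply: fin_bigcap_measurable => // i _; exact: mV.
  move=> w Ew i /=; rewrite !inE/= mem_iota => /andP[Ni _].
  by have := Ew (i - N)%N I; rewrite /= subnKC.
apply/eqP; rewrite eq_le measure_ge0 andbT.
apply/lee_addgt0Pr => r r0; rewrite add0e.
have := @cvg_expr R q.
rewrite ger0_norm// => /(_ q1)/cvgrPdist_le/(_ _ r0).
case=> k _ /(_ k (leqnn _)); rewrite sub0r normrN => hk.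
apply: (le_trans (Eq k)); rewrite lee_fin.
by rewrite (le_trans _ hk)// ler_norm.
Qed.
End infinitely_often.

(** * Masses of a Poisson-Dirichlet process *)

Section poisson_dirichlet.
Variable R : realType.

(** The absolute values make the series measurable on all sequences, so that
    this is an event of the sequence space and can be transported along an
    equality of laws. *)
Definition positive_partition : set (realseq R) :=
  [set u | (forall m, 0 < u m) /\ (\sum_(0 <= m <oo) (`|u m|)%:E = 1)%E].

Lemma measurable_coord m : measurable_fun setT (fun u : realseq R => u m).
Proof.
move=> _ B mB; apply: sub_sigma_algebra; exists m => //; exists B => //.
Qed.

Lemma measurable_positive_partition : measurable positive_partition.
Proof.
have -> : positive_partition =
  (\bigcap_m (fun u : realseq R => u m) @^-1` `]0, +oo[) `&`
   ((fun u : realseq R => (\sum_(0 <= m <oo) (`|u m|)%:E)%E) @^-1` [set 1%E]).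
  apply/seteqP; split => u [].
    by move=> u0 u1; split => // m _ /=; rewrite in_itv/= u0.
  by move=> u0 u1; split => // m; have := u0 m I; rewrite /= in_itv/= andbT.
apply: measurableI.
  apply: bigcapT_measurable => m; rewrite -[X in measurable X]setTI.
  exact: measurable_coord.
rewrite -[X in measurable X]setTI.
suff : measurable_fun setT
  (fun u : realseq R => (\sum_(0 <= m <oo) (`|u m|)%:E)%E).
  by apply => //; exact: emeasurable_set1.
apply: ge0_emeasurable_sum => [k t _ _|k _]; first by rewrite lee_fin.
apply/measurable_EFinP; apply: measurableT_comp => //; exact: measurable_coord.
Qed.

(** Positivity and the sum of a nonnegative series do not depend on the order of
    its terms. *)
Lemma rearrangement_positive_partition (V x : nat -> R) (e : R) : 0 < e ->
  (forall i, 0 < V i < 1) -> (forall N, exists2 i, (N <= i)%N & e <= V i) ->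
  decreasing_rearrangement (stick_breaking V) x -> positive_partition x.
Proof.
move=> e0 V01 Vio [_ [f [g gf fg] ->]].
have s0 m : 0 < stick_breaking V m.
  rewrite /stick_breaking mulr_gt0//; first by case/andP : (V01 m).
  by apply: prodr_gt0 => i _; rewrite subr_gt0; case/andP : (V01 i).
split; first by move=> m; exact: s0.
rewrite -(stick_breaking_sum1 e0 V01 Vio) !nneseries_esumT//.
- rewrite [RHS](reindex_esum setT setT f); last first.
    split => //; first by move=> ? ? _ _; exact: (can_inj gf).
    by move=> n _; exists (g n).
  by apply: eq_esum => m _; rewrite /= ger0_norm// ltW.
- by move=> n; rewrite lee_fin ltW.
Qed.

(** Makes the breaks almost surely lie strictly between 0 and 1. *)
Lemma beta1_setC01 (theta : R) : beta1 theta (~` `]0, 1[) = 0%E.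
Proof. by rewrite /beta1 setICl integral_set0. Qed.

(** The masses are a function of the breaks only in one realisation of the
    process; the event passes from it to x because it is a measurable set of
    sequences. *)
Lemma poisson_dirichlet_positive_partition (theta : R) d (T : measurableType d)
    (P : probability T R) (x : {RV P >-> realseq R}) :
  poisson_dirichlet theta x -> {ae P, forall w, positive_partition (x w)}.
Proof.
move=> [d' [T' [P' [V [x' [lawV indV rearr lawx]]]]]].
have V01 : {ae P', forall w, forall i, 0 < V i w < 1}.
  apply: ae_foralln => i; exists (V i @^-1` ~` `]0, 1[); split => //.
  - by rewrite -[X in measurable X]setTI; apply: measurable_funP => //;
      exact: measurableC.
  - by rewrite -(beta1_setC01 theta); apply: lawV; exact: measurableC.
have V0 : P' (V 0%N @^-1` [set r | 0 < r]) = 1%E.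
  have m0 : measurable (V 0%N @^-1` [set r | 0 < r]).
    by rewrite -[X in measurable X]setTI; apply: measurable_funP => //;
      rewrite -set_itvoy.
  apply: (etrans (congr1 P' (esym (setCK _)))).
  apply: (etrans (probability_setC P' (measurableC m0))).
  rewrite (_ : P' _ = 0%E) ?sube0//; apply: measure_negligible.
    exact: measurableC.
  apply: negligibleS V01 => w /= Vw V01; apply: Vw.
  by have /andP[] := V01 0%N.
have [e e0 Ve] := probability_lt_lt1 V0.
have idV i : P' (V i @^-1` [set r | (r < e)%R]) =
  P' (V 0%N @^-1` [set r | (r < e)%R]).
  have m : measurable [set r | (r < e)%R] by rewrite -set_itvNyo.
  by have := lawV i _ m; rewrite -(lawV 0%N _ m).
have Vio := independent_infinitely_often indV idV Ve.
have : {ae P', forall w, positive_partition (x' w)}.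
  apply: filterS3 V01 Vio rearr => w Vw Iw rw.
  exact: (rearrangement_positive_partition e0 Vw Iw rw).
move=> [N [mN N0 sN]].
have mC := measurableC measurable_positive_partition.
exists (x @^-1` ~` positive_partition); split => //.
  by rewrite -[X in measurable X]setTI; apply: measurable_funP.
have -> : P (x @^-1` ~` positive_partition) =
  P' (x' @^-1` ~` positive_partition) by exact: lawx.
apply/eqP; rewrite eq_le measure_ge0 andbT -N0; apply: le_measure;
  rewrite ?inE//.
by rewrite -[X in measurable X]setTI; apply: measurable_funP.
Qed.
End poisson_dirichlet.

(** * Intensity of the limit process *)

(** When c = +oo a single positive weight already makes the sum infinite. *)
Lemma nneseries_convex_cst (R : realType) (a : nat -> R) (c : \bar R) :
  (forall m, 0 < a m) -> (\sum_(0 <= m <oo) (a m)%:E = 1)%E -> (0 <= c)%E ->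
  (\sum_(0 <= m <oo) ((a m)%:E * c) = c)%E.
Proof.
move=> a0 a1; case: c => [c|_|//].
- move=> _; under eq_eseriesr do rewrite muleC.
  by rewrite nneseriesZl ?a1 ?mule1// => m _; rewrite lee_fin ltW.
- apply/eqP; rewrite eq_le leey/=.
  apply: le_trans (nneseries_lim_ge 1 _); last first.
    by move=> m _ _; rewrite mule_ge0// lee_fin ltW.
  by rewrite big_nat1 gt0_muley// lte_fin.
Qed.

Definition seq_coord (R : realType) (m : nat) (u : realseq R) : R := u m.

HB.instance Definition _ (R : realType) (m : nat) :=
  isMeasurableFun.Build _ _ _ _ (@seq_coord R m) (@measurable_coord R m).

Section limit.
Context d (T : measurableType d) (R : realType) (P : probability T R).

(** The product rule identifies the joint law of (X, Y) with the product of the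
    two laws, so that Y can be integrated first with X frozen. *)
Lemma independent_fubini (X Y : {RV P >-> R}) (f : R * R -> \bar R) :
  (forall B C, measurable B -> measurable C ->
    P (X @^-1` B `&` Y @^-1` C) = (P (X @^-1` B) * P (Y @^-1` C))%E) ->
  measurable_fun setT f -> (forall z, 0 <= f z)%E ->
  (\int[P]_w f (X w, Y w) = \int[P]_w \int[distribution P Y]_y f (X w, y))%E.
Proof.
move=> XY mf f0.
have mXY : measurable_fun setT (fun w => (X w, Y w)).
  by apply/measurable_fun_pairP; split; exact: measurable_funP.
have -> : (\int[P]_w f (X w, Y w) = \int[pushforward P (fun w => (X w, Y w))]_z
  f z)%E.
  by rewrite ge0_integral_pushforward.
pose push := pushforward_measure P mXY.
have -> : (\int[pushforward P (fun w => (X w, Y w))]_z f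
  z = \int[distribution P X \x distribution P Y]_z f z)%E.
  apply: eq_measure_integral => A mA _; apply/esym.
  exact: (@product_measure_unique _ _ _ _ _ _ _ push).
rewrite fubini_tonelli1// ge0_integral_distribution//.
  exact: measurable_fun_fubini_tonelli_F.
by move=> x; apply: integral_ge0.
Qed.

(** Carries an integral against the law of X, a measure on R with its Borel
    sets, to the uniform probability, which lives on the alias of R that
    supports Lebesgue measure. *)
Lemma integral_uniform_law (X : {RV P >-> R}) (f : R -> \bar R) :
  has_law X (uniform_prob (@ltr01 R)) ->
  measurable_fun setT f -> (forall r, 0 <= f r)%E ->
  (\int[distribution P X]_r f r = \int[lebesgue_measure]_(r in `[0%R, 1%R]) f
    r)%E.
Proof.
move=> lawX mf f0; rewrite ge0_integral_distribution//.
have mX : measurable_fun setT (X : T -> measurableTypeR R).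
  by move=> _ B mB; exact: (@measurable_funP _ _ _ _ setT X measurableT B mB).
pose push := pushforward_measure P mX.
transitivity (\int[push]_r f r)%E;
  first by rewrite (ge0_integral_pushforward mX).
rewrite (eq_measure_integral (uniform_prob (@ltr01 R))).
  by rewrite integral_uniform//= subr0 invr1 mul1e.
by move=> B mB _; exact: lawX.
Qed.

Variables (theta : R) (x : {RV P >-> realseq R}) (chi : nat -> {RV P >-> R}).
Hypothesis data : tau_infty_data theta x chi.

Let X m : {RV P >-> R} := seq_coord m \o x.

Let mX m : measurable_fun setT (fun w => x w m).
Proof. exact: (measurable_funP (X m)). Qed.

(** Conditionally on the mass the phase is uniform on [0, 1], which makes
    [integral_grid_count] applicable; the absolute value is almost surely the
    mass itself. *)
Lemma expected_grid_count m A : measurable A ->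
  (\int[P]_w grid_count (x w m) (chi m w) A =
   \int[P]_w ((`|x w m|)%:E * lebesgue_measure A))%E.
Proof.
move=> mA; have [pd unif indep] := data.
have mg : measurable_fun setT (fun z : R * R => grid_count z.1 z.2 A).
  exact: measurable_grid_count.
rewrite (@independent_fubini (X m) (chi m) (fun z => grid_count z.1 z.2 A))//;
  last 2 first.
- move=> B C mB mC.
  have := indep [fset None;
    Some m]%fset (fun i => if i is Some _ then chi m @^-1` C else X m @^-1` B).
  have -> : \bigcap_(i in [set` [fset None; Some m]%fset])
    (if i is Some _ then chi m @^-1` C else X m @^-1` B) =
    X m @^-1` B `&` chi m @^-1` C.
    apply/seteqP; split => w /=.
      move=> H; split; first by apply: (H None); rewrite /= !inE.
      by apply: (H (Some m)); rewrite /= !inE eqxx.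
    by move=> [Bw Cw] [i|].
  move=> ->.
    by rewrite big_fsetU1/= ?inE// big_seq_fset1.
  move=> [i|]; rewrite !inE//=.
    move=> /eqP[->]; exists C => //; exact: setTI.
  move=> _; exists (seq_coord m @^-1` B); last exact: setTI.
  rewrite -[X in measurable X]setTI; exact: measurable_coord.
- by move=> z; exact: grid_count_ge0.
apply: ge0_ae_eq_integral => //.
- have mF := @measurable_fun_fubini_tonelli_F _ _ _ _ _ (distribution P (chi m))
    _ mg (fun z => grid_count_ge0 _ _ _).
  exact: (measurableT_comp mF (mX m)).
- apply: emeasurable_funM => //; apply/measurable_EFinP.
  by apply: measurableT_comp => //; exact: mX.
- by move=> w _; apply: integral_ge0 => y _; exact: grid_count_ge0.
- by move=> w _; apply: mule_ge0.
apply: filterS (poisson_dirichlet_positive_partition pd) => w [xpos _] _.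
rewrite (integral_uniform_law (unif m) (measurable_grid_count mA _ _))//=;
  last by move=> u; exact: grid_count_ge0.
rewrite ger0_norm; last exact: ltW.
rewrite -(integral_grid_count 0 (xpos m) mA).
by apply: eq_integral => u _; rewrite addr0.
Qed.

Lemma correlation1_tau_infty A : measurable A ->
  correlation1 P (fun w => tau_infty (x w) (fun m => chi m w)) A =
    lebesgue_measure A.
Proof.
move=> mA; have [pd _ _] := data.
rewrite /correlation1 /tau_infty.
rewrite integral_nneseries//=; last 2 first.
- by move=> m; apply: (@measurable_grid_count R d T (fun w => x w m) (chi m)
    A) => //; exact: mX.
- by move=> m w _; exact: grid_count_ge0.
under eq_eseriesr do rewrite expected_grid_count//.
rewrite -integral_nneseries//=; last 2 first.
- move=> m; apply: emeasurable_funM => //; apply/measurable_EFinP.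
  by apply: measurableT_comp => //; exact: mX.
- by move=> m w _; apply: mule_ge0.
transitivity (\int[P]_w (cst (lebesgue_measure A) w))%E; last first.
  by rewrite integral_cst// [X in (_ * X)%E](probability_setT P) mule1.
apply: ge0_ae_eq_integral => //.
- apply: ge0_emeasurable_sum => [m w _ _|m _]; first by apply: mule_ge0.
  apply: emeasurable_funM => //; apply/measurable_EFinP.
  by apply: measurableT_comp => //; exact: mX.
- by move=> w _; apply: nneseries_ge0 => m _ _; apply: mule_ge0.
apply: filterS (poisson_dirichlet_positive_partition pd) => w [xpos x1] _ /=.
by rewrite nneseries_convex_cst// => m; rewrite normr_gt0 gt_eqF.
Qed.
End limit.

(** * The circle and its angles *)

Section circle.
Variable R : realType.
Implicit Types (s t : R) (k : int) (c : R[i]).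

Lemma circle_paramD s t : circle_param (s + t) =
  circle_param s * circle_param t.
Proof.
rewrite /circle_param mulrDr /expi cosD sinD; apply/eqP.
by rewrite eq_complex/= eqxx/= addrC.
Qed.

Lemma circle_param0 : circle_param 0 = 1 :> R[i].
Proof. by rewrite /circle_param mulr0 /expi cos0 sin0. Qed.

Lemma circle_param1 : circle_param 1 = 1 :> R[i].
Proof.
by rewrite /circle_param mulr1 mulr_natl /expi cos2pi sin2pi.
Qed.

Lemma circle_paramN t : circle_param (- t) * circle_param t = 1.
Proof. by rewrite -circle_paramD addNr circle_param0. Qed.

Lemma circle_param_nat (n : nat) : circle_param n%:R = 1 :> R[i].
Proof.
elim: n => [|n IH]; first exact: circle_param0.
by rewrite -natr1 circle_paramD IH circle_param1 mulr1.
Qed.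

Lemma circle_param_int k : circle_param k%:~R = 1 :> R[i].
Proof.
case: k => n; first exact: circle_param_nat.
by have := circle_paramN n.+1%:R; rewrite circle_param_nat mulr1 NegzE mulrNz.
Qed.

Lemma circle_param_neq0 t : circle_param t != 0.
Proof.
apply/eqP => t0; have := circle_paramN t.
by rewrite t0 mulr0 => /eqP; rewrite eq_sym oner_eq0.
Qed.

Lemma circle_param_norm t : `|circle_param t| = 1.
Proof. by rewrite normc_def /= cos2Dsin2 sqrtr1. Qed.

(** Modulo integers t may be taken in [0, 1); then cos (2 pi t) = 1 forces
    sin (pi t) = 0 with pi t in [0, pi), hence t = 0. *)
Lemma circle_param_eq1 t : circle_param t = 1 -> exists k, t = k%:~R.
Proof.
move=> t1; exists (Num.floor t).
pose u := t - (Num.floor t)%:~R.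
have : circle_param u = 1.
  by rewrite /u -mulrNz circle_paramD t1 circle_param_int mulr1.
have u0 : 0 <= u by rewrite subr_ge0 floor_le.
have u1 : u < 1.
  by rewrite ltrBlDr addrC -[1]/(1%:~R) -intrD floorD1_gt.
move=> [cu _].
have su : sin (pi * u) = 0.
  have e : 2 * pi * u = (pi * u) *+ 2 by rewrite mulr_natl mulrnAl.
  move: cu; rewrite e cos_mulr2n cos2sin2 => cu.
  by apply/eqP; rewrite -sqrf_eq0; apply/eqP; move: cu; lra.
suff : u = 0 by move/eqP; rewrite subr_eq0 => /eqP.
apply/eqP; rewrite eq_le u0 andbT leNgt; apply/negP => ugt0.
have := @sin_gt0_pi R (pi * u).
rewrite su ltxx mulr_gt0 ?pi_gt0//= -{2}[pi]mulr1 ltr_pM2l ?pi_gt0// u1.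
by move=> /(_ isT).
Qed.

Lemma circle_param_inj s t :
  circle_param s = circle_param t <-> exists k, s = t + k%:~R.
Proof.
split=> [st|[k ->]]; last by rewrite circle_paramD circle_param_int mulr1.
have [k sk] : exists k, s - t = k%:~R.
  by apply: circle_param_eq1; rewrite circle_paramD st mulrC circle_paramN.
by exists k; rewrite -sk addrC subrK.
Qed.

Lemma circle_param_surj c : `|c| = 1 ->
  exists2 t, 0 <= t <= 1 & c = circle_param t.
Proof.
case: c => a b c1.
have ab : a ^+ 2 + b ^+ 2 = 1.
  by apply: (@complexI R); rewrite (add_Re2_Im2 (Complex a b)) c1 expr1n.
clear c1.
have a1 : -1 <= a <= 1.
  by rewrite -ler_norml -(ler_pXn2r (_ : (0 < 2)%N)) ?nnegrE// expr1n real_normK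
    ?num_real// -ab lerDl sqr_ge0.
have ca : cos (acos a) = a by rewrite acosK.
have sa : sin (acos a) = `|b|.
  by rewrite sin_acos// -ab addrAC subrr add0r sqrtr_sqr.
have pi0 := @pi_gt0 R.
have [b0|b0] := leP 0 b.
- exists (acos a / (2 * pi)).
    rewrite divr_ge0 ?acos_ge0//=; last lra.
    rewrite ler_pdivrMr ?mul1r; last lra.
    by have := acos_lepi a1; lra.
  rewrite /circle_param mulrC divfK; last lra.
  by rewrite /expi ca sa ger0_norm.
- exists (1 - acos a / (2 * pi)).
    have := acos_lepi a1; have := acos_ge0 a1 => h1 h2.
    have h3 : 0 <= acos a / (2 * pi) by rewrite divr_ge0//; lra.
    have h4 : acos a / (2 * pi) <= 1.
      by rewrite ler_pdivrMr ?mul1r; lra.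
    lra.
  rewrite circle_paramD circle_param1 mul1r /circle_param mulrN mulrC divfK;
    last lra.
  by rewrite /expi cosN sinN ca sa ltr0_norm// opprK.
Qed.

End circle.

(** * Eigenvalues of a monomial matrix *)

Section monomial_matrix.

Lemma comp_poly_scaleX_inj (F : fieldType) (c : F) : c != 0 ->
  injective (fun p : {poly F} => p \Po (c *: 'X)).
Proof.
move=> c0 p q /(congr1 (fun p => p \Po (c^-1 *: 'X))).
by rewrite -!comp_polyA !comp_polyZ !comp_polyX scalerA mulfV// scale1r
  !comp_polyXr.
Qed.

(** Substituting c X for X in det (X - c A) gives c ^ n det (X - A). *)
Lemma char_poly_scale (F : fieldType) n (A : 'M[F]_n) (c : F) (r : 'I_n -> F) :
  c != 0 -> char_poly A = \prod_(i < n) ('X - (r i)%:P) ->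
  char_poly (c *: A) = \prod_(i < n) ('X - (c * r i)%:P).
Proof.
move=> c0 Ar; apply: (comp_poly_scaleX_inj c0) => /=.
rewrite rmorph_prod /=.
transitivity (c%:P ^+ n * char_poly A).
  rewrite /char_poly -det_map_mx -detZ; congr (\det _).
  apply/matrixP => i j; rewrite !mxE /= comp_polyB comp_polyC rmorphMn/=
    comp_polyX polyCM.
  by rewrite mulrBr mulrnAr -mul_polyC.
have -> : c%:P ^+ n = \prod_(i < n) c%:P by rewrite prodr_const card_ord.
rewrite Ar -big_split; apply: eq_bigr => i _ /=.
by rewrite comp_polyB comp_polyX comp_polyC polyCM mulrBr !mul_polyC.
Qed.

Variable R : realType.

Lemma Mmx_scale N (s : 'S_N) (z : 'I_N -> R[i]) (c : R[i]) :
  Mmx s (fun j => c * z j) = c *: Mmx s z.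
Proof. by apply/matrixP => j k; rewrite !mxE; case: ifP; rewrite ?mulr0. Qed.

(** The matrix permutes the coordinates of a left eigenvector and multiplies
    them by numbers of modulus 1, so it preserves the sum of their moduli, while
    the eigenvalue equation multiplies this sum by `|a|. *)
Lemma Mmx_root_norm N (s : 'S_N) (z : 'I_N -> R[i]) (a : R[i]) :
  (forall j, `|z j| = 1) -> root (char_poly (Mmx s z)) a -> `|a| = 1.
Proof.
move=> z1; rewrite -eigenvalue_root_char => /eigenvalueP[v vM v0].
have vE k : v 0 (s k) * z (s k) = a * v 0 k.
  have := congr1 (fun u : 'rV_N => u 0 k) vM; rewrite !mxE => <-.
  rewrite (bigD1 (s k))//= big1 ?addr0; first by rewrite mxE eqxx.
  by move=> j jk; rewrite mxE (negbTE jk) mulr0.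
have S0 : \sum_k `|v 0 k| != 0.
  apply: contra_neq v0 => S0; apply/rowP => k; rewrite mxE.
  apply/eqP; rewrite -normr_eq0; apply/eqP.
  exact: (psumr_eq0P (fun k _ => normr_ge0 (v 0 k)) S0).
apply: (mulIf S0); rewrite mul1r mulr_sumr.
rewrite [RHS](reindex_inj (@perm_inj _ s))/=; apply: eq_bigr => k _.
by rewrite -normrM -vE normrM z1 mulr1.
Qed.

(** The x with e(x / N) = e(y i) form the lattice N (Z + y i), and the
    multiplicity of an eigenvalue is the number of indices i that produce it. *)
Lemma tauN_grid_count N (M : 'M[R[i]]_N) (y : 'I_N -> R) (A : set R) :
  (0 < N)%N -> char_poly M = \prod_(i < N) ('X - (circle_param (y i))%:P) ->
  tauN M A = (\sum_(i < N) grid_count N%:R^-1 (y i) A)%E.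
Proof.
move=> N0 My; rewrite /tauN.
have N0' : N%:R != 0 :> R by rewrite pnatr_eq0 -lt0n.
pose S i : set R := [set x | circle_param (x / N%:R) = circle_param (y i)].
have eE (x : R) : expi (2 * pi * x / N%:R) = circle_param (x / N%:R).
  by rewrite /circle_param mulrA.
transitivity (\esum_(x in [set: R]) \sum_(i < N)
  (if x \in S i then \d_x A else 0 : \bar R))%E.
  rewrite esum_mkcond; apply: eq_esum => x _.
  have mupE : mup (circle_param (x / N%:R)) (char_poly M) =
    (\sum_(i < N) (x \in S i))%N.
    rewrite My -(big_map (fun i => circle_param (y i)) xpredT
      (fun c => 'X - c%:P)).
    rewrite mu_prod_XsubC count_map -sum1_count big_mkcond/=;
      apply: eq_bigr => i _.
    by case: eqP => h; [rewrite mem_set|rewrite memNset// => /esym].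
  have root_S : root (char_poly M) (circle_param (x / N%:R)) =
    (0 < \sum_(i < N) (x \in S i))%N.
    by rewrite -mupE -XsubC_dvd ?dvdp_XsubCl// monic_neq0// char_poly_monic.
  transitivity ((\sum_(i < N) (x \in S i))%:R%:E * \d_x A : \bar R)%E.
    case: ifPn => [_|]; first by rewrite eE mupE.
    rewrite notin_setE/= eE eigenvalue_root_char root_S => /negP.
    by rewrite -eqn0Ngt => /eqP ->; rewrite mul0e.
  rewrite natr_sum -sumEFin ge0_sume_distrl//.
  by apply: eq_bigr => i _; case: (x \in S i); rewrite ?mul1e ?mul0e.
rewrite esum_sum; last by move=> x i _ _; case: ifP.
apply: eq_bigr => i _; rewrite -esum_mkcond.
rewrite (reindex_esum [set: int] (S i) (fun k => (k%:~R + y i) / N%:R^-1))//.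
rewrite /S; split.
- by move=> k _ /=; rewrite invrK mulfK// addrC circle_paramD circle_param_int
    mulr1.
- move=> k l _ _ /= /(divIf (invr_neq0 N0'))/addIr/eqP.
  by rewrite eqr_int => /eqP.
- move=> x /= /circle_param_inj[k xk]; exists k => //.
  by rewrite invrK addrC -xk divfK.
Qed.
End monomial_matrix.

(** * Measurability of complex functions and of polynomial coefficients *)

Section complex_measurability.
Context d (E : measurableType d) (R : realType).
Implicit Types f g : E -> R[i].

Lemma measurable_Re : measurable_fun setT (@complex.Re R).
Proof.
move=> _ B mB; rewrite setTI; apply: sub_sigma_algebra; left; exists B => //.
by rewrite setTI.
Qed.

Lemma measurable_Im : measurable_fun setT (@complex.Im R).
Proof.
move=> _ B mB; rewrite setTI; apply: sub_sigma_algebra; right; exists B => //.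
by rewrite setTI.
Qed.

Lemma measurable_complexP f : measurable_fun setT f <->
  measurable_fun setT (fun e => complex.Re (f e)) /\
  measurable_fun setT (fun e => complex.Im (f e)).
Proof.
split=> [mf|[mR mI]].
  by split; [exact: (measurableT_comp measurable_Re)|exact:
    (measurableT_comp measurable_Im)].
apply: (@measurability _ _ _ _ setT f) => //.
by move=> _ [_ [[B mB <-]|[B mB <-]] <-];
  rewrite !setTI -comp_preimage -[X in measurable X]setTI;
  [exact: mR|exact: mI].
Qed.

Lemma measurable_complexD f g : measurable_fun setT f ->
  measurable_fun setT g ->
  measurable_fun setT (fun e => f e + g e).
Proof.
move=> /measurable_complexP[fR fI] /measurable_complexP[gR gI].
apply/measurable_complexP; split.
  rewrite (_ : (fun _ => _) = (fun e => complex.Re (f e) + complex.Re (g e))).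
    exact: measurable_funD.
  by apply/funext => e; case: (f e) (g e) => ? ? [].
rewrite (_ : (fun _ => _) = (fun e => complex.Im (f e) + complex.Im (g e))).
  exact: measurable_funD.
by apply/funext => e; case: (f e) (g e) => ? ? [].
Qed.

Lemma measurable_complexM f g : measurable_fun setT f ->
  measurable_fun setT g ->
  measurable_fun setT (fun e => f e * g e).
Proof.
move=> /measurable_complexP[fR fI] /measurable_complexP[gR gI].
apply/measurable_complexP; split.
  rewrite (_ : (fun _ => _) =
    (fun e => complex.Re (f e) * complex.Re (g e) - complex.Im (f e) *
    complex.Im (g e))).
    by apply: measurable_funB; exact: measurable_funM.
  by apply/funext => e; case: (f e) (g e) => ? ? [].
rewrite (_ : (fun _ => _) =
  (fun e => complex.Re (f e) * complex.Im (g e) + complex.Im (f e) * complex.Re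
  (g e))).
  by apply: measurable_funD; exact: measurable_funM.
by apply/funext => e; case: (f e) (g e) => ? ? [].
Qed.

Lemma measurable_complex_sum I (s : seq I) (F : I -> E -> R[i]) :
  (forall i, measurable_fun setT (F i)) ->
  measurable_fun setT (fun e => \sum_(i <- s) F i e).
Proof.
move=> mF; elim: s => [|i s IH].
  by under eq_fun do rewrite big_nil; exact: measurable_cst.
by under eq_fun do rewrite big_cons; exact: measurable_complexD.
Qed.

Definition measurable_coefs (p : E -> {poly R[i]}) :=
  forall k, measurable_fun setT (fun e => (p e)`_k).

Lemma measurable_coefs_cst (p : {poly R[i]}) : measurable_coefs (fun=> p).
Proof. by move=> k; exact: measurable_cst. Qed.

Lemma measurable_coefs_polyC f : measurable_fun setT f ->
  measurable_coefs (fun e => (f e)%:P).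
Proof.
move=> mf k; under eq_fun do rewrite coefC.
by case: eqP => _ //; exact: measurable_cst.
Qed.

Lemma measurable_coefsD (p q : E -> {poly R[i]}) :
  measurable_coefs p -> measurable_coefs q ->
    measurable_coefs (fun e => p e + q e).
Proof.
by move=> mp mq k; under eq_fun do rewrite coefD; exact: measurable_complexD.
Qed.

Lemma measurable_coefsM (p q : E -> {poly R[i]}) :
  measurable_coefs p -> measurable_coefs q ->
    measurable_coefs (fun e => p e * q e).
Proof.
move=> mp mq k; under eq_fun do rewrite coefM.
by apply: measurable_complex_sum => i; exact: measurable_complexM.
Qed.

Lemma measurable_coefs_det n (A : E -> 'M[{poly R[i]}]_n) :
  (forall i j, measurable_coefs (fun e => A e i j)) ->
  measurable_coefs (fun e => \det (A e)).
Proof.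
move=> mA.
have mprod (s : {perm 'I_n}) (r : seq 'I_n) :
  measurable_coefs (fun e => \prod_(i <- r) A e i (s i)).
  elim: r => [|i r IH].
    by under eq_fun do rewrite big_nil; exact: measurable_coefs_cst.
  by under eq_fun do rewrite big_cons; exact: measurable_coefsM.
move=> k; under eq_fun do rewrite coef_sum.
apply: measurable_complex_sum => s.
exact: (measurable_coefsM (measurable_coefs_cst _) (mprod s _)).
Qed.

Lemma measurable_coefs_char_poly n (A : E -> 'M[R[i]]_n) :
  (forall i j, measurable_fun setT (fun e => A e i j)) ->
  measurable_coefs (fun e => char_poly (A e)).
Proof.
move=> mA; apply: measurable_coefs_det => i j.
under eq_fun do rewrite !mxE.
apply: measurable_coefsD; first exact: measurable_coefs_cst.
under eq_fun do rewrite -mulN1r.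
apply: measurable_coefsM; first exact: measurable_coefs_cst.
exact: measurable_coefs_polyC.
Qed.

End complex_measurability.

(** * Measurable choice of a least zero *)

Section least_zero.
Context d (E : measurableType d) (R : realType) (h : E -> R -> R).
Hypothesis mh : forall t, measurable_fun setT (h^~ t).
Hypothesis ch : forall e, continuous (h e).
Hypothesis h0 : forall e t, 0 <= h e t.

(** A continuous nonnegative function vanishes somewhere on a segment if and
    only if its infimum there is 0, and by density the infimum may be taken over
    the countable set of rationals projected to the segment. *)
Lemma zero_in_segmentP (e : E) (s : R) : 0 <= s ->
  (exists2 t, 0 <= t <= s & h e t = 0) <->
  (forall n, exists q : rat, h e (Num.min (Num.max (ratr q) 0) s) < n.+1%:R^-1).
Proof.
move=> s0; split=> [[t /andP[t0 ts] ht] n|H].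
  pose g (u : R) := h e (Num.min (Num.max u 0) s).
  have cg : continuous g.
    move=> u; apply: (@continuous_comp _ _ _
      (fun u : R => Num.min (Num.max u 0) s) (h e)); last exact: ch.
    apply: (@continuous_min R R (fun u => Num.max u 0) (cst s));
      last exact: cst_continuous.
    by apply: (@continuous_max R R id (cst 0)); last exact: cst_continuous.
  have og : open (g @^-1` [set r | r < n.+1%:R^-1]).
    by move/continuousP : cg; apply; exact: open_lt.
  have [|r [gr [q _ qr]]] := dense_rat _ og.
    exists t; rewrite /g /= max_l// min_l// ht invr_gt0; exact: ltr0Sn.
  by exists q; rewrite qr.
have [c + cmin] := EVT_min s0 (continuous_subspaceT (@ch e)).
rewrite in_itv/= => cs; exists c => //.
apply/eqP; rewrite eq_le h0 andbT leNgt; apply/negP => c0.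
have [n _ /(_ n (leqnn _))/= hn] := near_infty_natSinv_lt (PosNum c0).
have [q] := H n; apply/negP; rewrite -leNgt (le_trans (ltW hn))//=.
apply: cmin; rewrite in_itv/= ge_min lexx orbT andbT.
by rewrite le_min s0 le_max lexx orbT.
Qed.

Hypothesis hz : forall e, exists2 t, 0 <= t & h e t = 0.

Lemma least_zero_ex e : exists t, [/\ 0 <= t, h e t = 0 &
  forall u, 0 <= u -> h e u = 0 -> t <= u].
Proof.
have [t t0 ht] := hz e.
pose Z := [set u | h e u = 0] `&` `[0, t].
have cZ : compact Z.
  rewrite /Z setIC; apply: compact_closedI; first exact: segment_compact.
  apply: (@closed_comp _ _ (h e) [set 0]) => [u _|]; first exact: ch.
  exact/accessible_closed_set1/hausdorff_accessible/Rhausdorff.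
have Z0 : Z !=set0 by exists t; split => //=; rewrite in_itv/= t0 lexx.
have [c /set_mem[hc]] :=
  compact_EVT_min Z0 cZ (continuous_subspaceT (fun x => @cvg_id _ _) :
  {within Z, continuous id}).
rewrite /= in_itv/= => /andP[c0 ct] cmin.
exists c; split => // u u0 hu.
have [ut|tu] := leP u t; last by rewrite (le_trans ct)// ltW.
by apply: cmin; apply/mem_set; split => //=; rewrite in_itv/= u0.
Qed.

(** The least zero is at most s exactly when there is a zero in [0, s], a
    countable combination of events by [zero_in_segmentP]. *)
Lemma measurable_least_zero : exists x : E -> R,
  measurable_fun setT x /\ forall e, h e (x e) = 0.
Proof.
pose x e := sval (cid (least_zero_ex e)).
have xP e : [/\ 0 <= x e, h e (x e) = 0 & forall u, 0 <= u -> h e u = 0 ->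
  x e <= u].
  exact: svalP (cid (least_zero_ex e)).
exists x; split; last by move=> e; have [] := xP e.
have mle s : measurable [set e | x e <= s].
  have [s0|s0] := leP 0 s; last first.
    rewrite (_ : [set _ | _] = set0)//; apply/seteqP; split => // e /= xs.
    by have [x0 _ _] := xP e; have := le_lt_trans (le_trans x0 xs) s0;
      rewrite ltxx.
  rewrite (_ : [set _ | _] = \bigcap_n \bigcup_(q : rat)
      ((h^~ (Num.min (Num.max (ratr q) 0) s)) @^-1` [set r | r < n.+1%:R^-1])).
    apply: bigcapT_measurable => n; apply: bigcupT_measurable_rat => q.
    by rewrite -[X in measurable X]setTI; apply: mh => //; rewrite -set_itvNyo.
  apply/seteqP; split => e /=.
    move=> xs n _; have [x0 hx _] := xP e.
    have /(zero_in_segmentP e s0)/(_ n)[q hq] : exists2 t, 0 <= t <= s & h e t =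
      0.
      by exists (x e) => //; rewrite x0.
    by exists q.
  move=> H; have [t /andP[t0 ts] ht] : exists2 t, 0 <= t <= s & h e t = 0.
    by apply/zero_in_segmentP => // n; have [q _ hq] := H n I; exists q.
  by have [_ _ xmin] := xP e; rewrite (le_trans (xmin t t0 ht)).
apply: (measurability _ (RGenOInfty.measurableE R)) => //.
move=> _ [_ [s ->] <-]; rewrite setTI.
rewrite (_ : _ @^-1` _ = ~` [set e | x e <= s]); first exact: measurableC.
by apply/seteqP; split => e /=; rewrite in_itv/= andbT ltNge => /negP.
Qed.

End least_zero.

(** * Measurable choice of the roots of a polynomial *)

Section measurable_roots.
Variable R : realType.

Lemma continuous_horner_circle (p : {poly R[i]}) :
  continuous (fun t : R => complex.Re p.[circle_param t]) /\
  continuous (fun t : R => complex.Im p.[circle_param t]).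
Proof.
have clin : continuous (fun t : R => 2 * pi * t) by move=> t;
  exact: mulrl_continuous.
have ccos : continuous (fun t : R => complex.Re (circle_param t)).
  by move=> t; apply: (continuous_comp (clin t)); exact: continuous_cos.
have csin : continuous (fun t : R => complex.Im (circle_param t)).
  by move=> t; apply: (continuous_comp (clin t)); exact: continuous_sin.
elim/poly_ind: p => [|p [a b] [cR cI]].
  by split; under eq_fun do rewrite horner0; exact: cst_continuous.
split; under eq_fun do rewrite hornerMXaddC.
- rewrite [X in continuous X](_ : _ =
    (fun t : R => complex.Re p.[circle_param t] * complex.Re (circle_param t)
     - complex.Im p.[circle_param t] * complex.Im (circle_param t) + a)).
    move=> t; have cc := continuousM (cR t) (ccos t).
    exact: (continuousD (continuousB cc (continuousM (cI t) (csin t)))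
      (@cst_continuous R R a t)).
  by apply/funext => t; case: p.[circle_param t] => u v; case: (circle_param t).
- rewrite [X in continuous X](_ : _ =
    (fun t : R => complex.Re p.[circle_param t] * complex.Im (circle_param t)
     + complex.Im p.[circle_param t] * complex.Re (circle_param t) + b)).
    move=> t; have cc := continuousM (cR t) (csin t).
    exact: (continuousD (continuousD cc (continuousM (cI t) (ccos t)))
      (@cst_continuous R R b t)).
  by apply/funext => t; case: p.[circle_param t] => u v; case: (circle_param t).
Qed.

Context d (E : measurableType d).

Lemma measurable_horner n (p : E -> {poly R[i]}) (c : R[i]) :
  measurable_coefs p -> (forall e, size (p e) <= n)%N ->
  measurable_fun setT (fun e => (p e).[c]).
Proof.
move=> mp pn; under eq_fun do rewrite (horner_coef_wide _ (pn _)).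
apply: measurable_complex_sum => i.
by apply: measurable_complexM; [exact: mp|exact: measurable_cst].
Qed.

(** Apply the least zero to the squared modulus of p on the circle. *)
Lemma measurable_circle_root n (p : E -> {poly R[i]}) :
  measurable_coefs p -> (forall e, size (p e) <= n)%N ->
  (forall e, exists2 t : R, 0 <= t & root (p e) (circle_param t)) ->
  exists y : E -> R, measurable_fun setT y /\ forall e,
    root (p e) (circle_param (y e)).
Proof.
move=> mp pn pr.
pose h e (t : R) := complex.Re (p e).[circle_param t] ^+ 2 + complex.Im
  (p e).[circle_param t] ^+ 2.
have hroot e t : h e t = 0 <-> root (p e) (circle_param t).
  rewrite /h /root; case: (p e).[_] => a b /=; split.
    move/eqP; rewrite paddr_eq0 ?sqr_ge0// !sqrf_eq0 => /andP[/eqP -> /eqP ->].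
    exact: eqxx.
  by rewrite eq_complex/= => /andP[/eqP -> /eqP ->]; rewrite expr0n addr0.
have [t|e t|e t|e|y [my yr]] := @measurable_least_zero _ E R h.
- have /measurable_complexP[mR mI] := measurable_horner (circle_param t) mp pn.
  by apply: measurable_funD; exact: measurable_funX.
- have [cR cI] := continuous_horner_circle (p e).
  exact: (continuousD (continuousM (cR t) (cR t)) (continuousM (cI t) (cI t))).
- by rewrite addr_ge0// sqr_ge0.
- by have [t t0 rt] := pr e; exists t => //; apply/hroot.
by exists y; split => // e; apply/hroot.
Qed.

(** From p = q (X - c) the coefficients of q satisfy q_k = p_(k+1) + c q_(k+1):
    descend from the vanishing ones. *)
Lemma measurable_coefs_divXsubC n (p : E -> {poly R[i]}) (c : E -> R[i]) :
  measurable_coefs p -> (forall e, size (p e) <= n)%N ->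
  measurable_fun setT c -> (forall e, root (p e) (c e)) ->
  measurable_coefs (fun e => p e %/ ('X - (c e)%:P)).
Proof.
move=> mp pn mc rc k.
have qE e j : (p e %/ ('X - (c e)%:P))`_j =
    (p e)`_j.+1 + (p e %/ ('X - (c e)%:P))`_j.+1 * c e.
  have pe : p e = p e %/ ('X - (c e)%:P) * ('X - (c e)%:P).
    by rewrite divpK// dvdp_XsubCl rc.
  by rewrite [in X in _ = X + _]pe mulrBr coefB coefMX coefMC subrK.
have [m] : exists m, (n <= k + m)%N by exists n; rewrite leq_addl.
elim: m k => [|m IH] k nk.
  rewrite (_ : (fun _ => _) = cst 0); first exact: measurable_cst.
  apply/funext => e; rewrite /= nth_default//.
  rewrite size_divp ?polyXsubC_eq0// (leq_trans (leq_subr _ _))//.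
  by rewrite (leq_trans (pn e))// -(addn0 k).
under eq_fun do rewrite qE.
apply: measurable_complexD; first exact: mp.
by apply: measurable_complexM => //; apply: IH; rewrite addSnnS.
Qed.

(** One measurable root is divided out; the quotient is again monic with
    measurable coefficients and roots on the circle. *)
Lemma measurable_circle_roots n (p : E -> {poly R[i]}) :
  measurable_coefs p -> (forall e, p e \is monic) ->
  (forall e, size (p e) = n.+1) ->
  (forall e a, root (p e) a -> `|a| = 1) ->
  exists y : 'I_n -> E -> R, (forall i, measurable_fun setT (y i)) /\
    forall e, p e = \prod_(i < n) ('X - (circle_param (y i e))%:P).
Proof.
elim: n p => [|n IH] p mp mon sz r1.
  exists (fun _ _ => 0); split=> [[]//|e]; rewrite big_ord0.
  have /size1_polyC pe : (size (p e) <= 1)%N by rewrite sz.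
  by move: (mon e); rewrite pe monicE lead_coefC => /eqP ->.
have pn e : (size (p e) <= n.+2)%N by rewrite sz.
have [e|y0 [my0 ry0]] := measurable_circle_root mp pn.
  have /closed_rootP[a ra] : size (p e) != 1%N by rewrite sz.
  have [t /andP[t0 _] at_] := circle_param_surj (r1 e a ra).
  by exists t => //; rewrite -at_.
pose c e := circle_param (y0 e).
have mc : measurable_fun setT c.
  exact: (measurableT_comp (@measurable_circle_param R)).
pose q e := p e %/ ('X - (c e)%:P).
have pE e : p e = q e * ('X - (c e)%:P) by rewrite divpK// dvdp_XsubCl ry0.
have [|e|e|e a ra|y [my yE]] := IH q.
- exact: (measurable_coefs_divXsubC mp pn mc ry0).
- by have := mon e; rewrite pE monicMr// monicXsubC.
- by rewrite size_divp ?polyXsubC_eq0// sz size_XsubC subn1.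
- by apply: (r1 e); rewrite pE rootM ra.
exists (fun i => if unlift ord0 i is Some j then y j else y0); split.
  by move=> i; case: unlift.
move=> e; rewrite big_ord_recl unlift_none pE mulrC yE; congr (_ * _).
by apply: eq_bigr => i _; rewrite liftK.
Qed.

End measurable_roots.

(** * Integrals of functions that agree almost everywhere *)

Section integral_ae.
Context d (T : measurableType d) (R : realType)
  (mu : {measure set T -> \bar R}).

(** For nonnegative functions the integral is a supremum over the simple
    functions below, hence monotone even without measurability. *)
Lemma ge0_le_integral_sup (f g : T -> \bar R) :
  (forall x, 0 <= f x)%E -> (forall x, f x <= g x)%E ->
  (\int[mu]_x f x <= \int[mu]_x g x)%E.
Proof.
move=> f0 fg; have g0 x : (0 <= g x)%E by exact: le_trans (f0 x) (fg x).
rewrite !ge0_integralTE//; apply: le_ereal_sup => _ [h hf <-].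
by exists h => // x; exact: le_trans (hf x) (fg x).
Qed.

(** A version for a function f that may fail to be measurable: it is squeezed
    between modifications of g on a null set, by 0 and by +oo, which have the
    same integral as g. *)
Lemma ge0_integral_ae_eq_measurable (f g : T -> \bar R) :
  (forall x, 0 <= f x)%E -> (forall x, 0 <= g x)%E ->
  measurable_fun setT g -> {ae mu, forall x, f x = g x} ->
  (\int[mu]_x f x = \int[mu]_x g x)%E.
Proof.
move=> f0 g0 mg [N [mN N0 fgN]].
have fg x : ~ N x -> f x = g x.
  by move=> Nx; apply: contrapT => /fgN.
apply/eqP; rewrite eq_le; apply/andP; split.
- pose u x := (g x + +oo * (\1_N x)%:E)%E.
  have mI : measurable_fun setT (fun x => (+oo * (\1_N x : R)%:E)%E).
    apply: emeasurable_funM => //; apply/measurable_EFinP;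
      exact: measurable_indic.
  have I0 x : (0 <= +oo * (\1_N x : R)%:E)%E by rewrite mule_ge0// lee_fin.
  rewrite [leRHS](_ : _ = \int[mu]_x u x)%E.
    apply: ge0_le_integral_sup => // x; rewrite /u indicE.
    have [Nx|/negP Nx] := boolP (x \in N).
      by rewrite mulr1n mule1 addeC addye ?leey// gt_eqF//
        (lt_le_trans _ (g0 x)).
    by rewrite mulr0n mule0 adde0 fg// => /mem_set.
  apply: ge0_ae_eq_integral => //; first exact: emeasurable_funD.
    by move=> x _; rewrite adde_ge0.
  exists N; split => // x /= H; apply: contrapT => Nx; apply: H => _.
  by rewrite /u indicE memNset// mule0 adde0.
- pose u x := (g x * (\1_(~` N) x)%:E)%E.
  rewrite [leLHS](_ : _ = \int[mu]_x u x)%E.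
    apply: ge0_le_integral_sup => x; first by rewrite mule_ge0// lee_fin.
    rewrite /u indicE in_setC; have [Nx|/negP Nx] := boolP (x \in N).
      by rewrite /= mule0.
    by rewrite /= mule1 fg// => /mem_set.
  apply: ge0_ae_eq_integral => //.
    apply: emeasurable_funM => //; apply/measurable_EFinP;
      apply: measurable_indic.
    exact: measurableC.
    by move=> x _; rewrite mule_ge0// lee_fin.
  exists N; split => // x /= H; apply: contrapT => Nx; apply: H => _.
  by rewrite /u indicE mem_set// mule1.
Qed.
End integral_ae.

(** * Rotation invariance of the uniform law on the circle *)

Section rotation.
Variable R : realType.
Local Notation mu := (@lebesgue_measure R).

(** Exactly one translate v + k falls in [0, 1), and periodicity allows the
    indicator of D to be evaluated at v instead. *)
Lemma grid_count_periodic (D : set R) (v : R) :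
  (forall t (k : int), D (t + k%:~R) <-> D t) ->
  grid_count 1 v (D `&` `[0, 1[) = (\1_D v)%:E.
Proof.
move=> Dper.
pose k0 := - Num.floor v.
transitivity (\esum_(k in [set: int]) if k \in [set k0] then (\1_D v)%:E else
  0 : \bar R)%E.
  apply: eq_esum => k _; rewrite divr1 diracE.
  rewrite in_setI addrC [(_ + _ \in D)](_ : _ = (v \in D)); last first.
    by apply/idP/idP => /set_mem/Dper/mem_set.
  have -> : (v + k%:~R \in `[0, 1[%classic) = (k \in [set k0]).
    apply/idP/idP => /set_mem/=.
      rewrite in_itv/= => /andP[h1 h2]; apply/mem_set => /=.
      rewrite /k0 (@floor_def _ v (- k)) ?opprK// intrD mulrNz.
      by apply/andP; split; lra.
    move=> ->; apply/mem_set; rewrite /= in_itv/= /k0 mulrNz.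
    by have := floor_itv v; rewrite intrD => /andP[h1 h2]; apply/andP; split;
      lra.
  by rewrite indicE; case: (k \in _); rewrite ?andbT ?andbF.
by rewrite -esum_mkcond esum_set1// lee_fin.
Qed.

(** By [grid_count_periodic] the left-hand side is the average over t of a
    lattice count with offset t + s, and [integral_grid_count] does not depend
    on s. *)
Lemma uniform_prob_rotation (D : set R) (s : R) : measurable D ->
  (forall t (k : int), D (t + k%:~R) <-> D t) ->
  uniform_prob (@ltr01 R) ((fun t => t + s) @^-1` D) = mu (D `&` `[0, 1[).
Proof.
move=> mD Dper.
have ms : measurable_fun setT (fun t : R => t + s) by exact: measurable_funD.
have mDs : measurable ((fun t => t + s) @^-1` D).
  by rewrite -[X in measurable X]setTI; exact: ms.
transitivity (\int[uniform_prob (@ltr01 R)]_t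
  (\1_((fun t => t + s) @^-1` D) t)%:E)%E.
  by rewrite integral_indic// setIT.
have mI : measurable_fun setT
  (\1_((fun t : R => t + s) @^-1` D) : measurableTypeR R -> R).
  exact: measurable_indic.
rewrite integral_uniform//; last exact/measurable_EFinP.
rewrite subr0 invr1 mul1e.
have mD1 : measurable (D `&` `[0, 1[) by exact: measurableI.
rewrite -[RHS]mul1e -(integral_grid_count s ltr01 mD1).
by apply: eq_integral => t _; rewrite grid_count_periodic.
Qed.

Lemma uniform_circle_rotation (s : R) (B : set R[i]) : measurable B ->
  uniform_circle R ((fun c => circle_param s * c) @^-1` B) = uniform_circle R B.
Proof.
move=> mB; pose D : set R := (@circle_param R) @^-1` B.
have mD : measurable D.
  by rewrite -[X in measurable X]setTI; exact: measurable_circle_param.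
have Dper t (k : int) : D (t + k%:~R) <-> D t.
  by rewrite /D /= circle_paramD circle_param_int mulr1.
transitivity (mu (D `&` `[0, 1[)).
  rewrite -(uniform_prob_rotation s mD Dper); congr (uniform_prob _ _).
  by apply/seteqP; split => t; rewrite /D/= addrC circle_paramD.
rewrite -(uniform_prob_rotation 0 mD Dper); congr (uniform_prob _ _).
by apply/seteqP; split => t; rewrite /D/= addr0.
Qed.

Lemma uniform_circle_norm : uniform_circle R [set c | `|c| != 1] = 0%E.
Proof.
rewrite [LHS](_ : _ = uniform_prob (@ltr01 R) set0); first by rewrite measure0.
congr (uniform_prob _ _); apply/seteqP; split => // t /=.
by rewrite circle_param_norm eqxx.
Qed.
End rotation.

(** * The joint law of the permutation and of the entries *)

Definition rectangle (R : realType) N (S : set 'S_N) (B : 'I_N -> set R[i]) :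
    set ('S_N * ('I_N -> R[i])) :=
  [set e | S e.1 /\ forall j, B j (e.2 j)].

(** The generators, stable under intersection, of the product sigma-algebra on
    the space of pairs (permutation, family of entries). *)
Definition rectangles (R : realType) N : set (set ('S_N * ('I_N -> R[i]))) :=
  [set A | exists S B, (forall j, measurable (B j)) /\ A = @rectangle R N S B].

Section matrix_data.
Variables (R : realType) (N : nat).
Local Notation data := (g_sigma_algebraType (@rectangles R N)).

Lemma rectangles_setI : setI_closed (@rectangles R N).
Proof.
move=> _ _ [S [B [mB ->]]] [S' [B' [mB' ->]]].
exists (S `&` S'), (fun j => B j `&` B' j); split.
  by move=> j; exact: measurableI.
apply/seteqP; split=> e; rewrite /rectangle/=.
  by move=> [[? H] [? H']].
by move=> [[? ?] H]; split; split => // j; case: (H j).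
Qed.

Lemma rectangles_setT : @rectangles R N setT.
Proof. by exists setT, (fun=> setT); split => //; apply/seteqP; split. Qed.

Lemma measurable_data_perm (S : set 'S_N) :
  measurable ([set e | S e.1] : set data).
Proof.
apply: sub_sigma_algebra; exists S, (fun=> setT); split => //.
by apply/seteqP; split => // e [].
Qed.

Lemma measurable_data_entry j : measurable_fun setT (fun e : data => e.2 j).
Proof.
move=> _ B mB; rewrite setTI; apply: sub_sigma_algebra.
exists setT, (fun k => if k == j then B else setT); split.
  by move=> k; case: ifP.
apply/seteqP; split => e; rewrite /rectangle/=.
  by move=> Be; split => // k; case: eqP => // ->.
by move=> [_ /(_ j)]; rewrite eqxx.
Qed.

Lemma measurable_to_data d (T : measurableType d) (s : T -> 'S_N)
  (z : 'I_N -> T -> R[i]) :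
  (forall S, measurable (s @^-1` S)) -> (forall j, measurable_fun setT (z j)) ->
  measurable_fun setT (fun w => (s w, fun j => z j w) : data).
Proof.
move=> ms mz; apply: (@measurability _ _ _ _ setT
  (fun w => (s w, fun j => z j w) : data)) => //.
move=> _ [_ [S [B [mB ->]]] <-]; rewrite setTI.
rewrite (_ : _ @^-1` _ =
  s @^-1` S `&` \bigcap_(j in [set: 'I_N]) z j @^-1` B j).
  apply: measurableI => //; apply: fin_bigcap_measurable => // j _.
  by rewrite -[X in measurable X]setTI; exact: mz.
apply/seteqP; split => w; rewrite /rectangle/=.
  by move=> [Sw H]; split => // j _; exact: H.
by move=> [Sw H]; split => // j; exact: H.
Qed.

(** Moves the exceptional entries to the circle, so that a choice of eigenangles
    exists everywhere and not only almost surely. *)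
Definition to_circle (c : R[i]) : R[i] := if `|c| == 1 then c else 1.

Lemma to_circle_norm c : `|to_circle c| = 1.
Proof. by rewrite /to_circle; case: eqP => // _; rewrite normr1. Qed.

Lemma to_circle_id c : `|c| = 1 -> to_circle c = c.
Proof. by move=> c1; rewrite /to_circle c1 eqxx. Qed.

Lemma measurable_unit_circle : measurable [set c : R[i] | `|c| == 1].
Proof.
pose g (c : R[i]) := complex.Re c ^+ 2 + complex.Im c ^+ 2.
have mg : measurable_fun setT g.
  by apply: measurable_funD; apply: measurable_funX;
    [exact: measurable_Re|exact: measurable_Im].
rewrite (_ : [set _ | _] = g @^-1` [set 1]).
  by rewrite -[X in measurable X]setTI; exact: mg.
apply/seteqP; split => c; rewrite /g/=.
  move=> /eqP c1; apply: (@complexI R).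
  by rewrite add_Re2_Im2 c1 expr1n.
move=> c1; have := add_Re2_Im2 c; rewrite c1 => /esym/eqP.
by rewrite (_ : (1 : R)%:C%C = 1) // sqrp_eq1.
Qed.

Lemma measurable_to_circle : measurable_fun setT to_circle.
Proof.
have mb : measurable_fun setT (fun c : R[i] => `|c| == 1).
  apply: (measurable_fun_bool true); rewrite setTI;
    exact: measurable_unit_circle.
exact: measurable_fun_if.
Qed.

Lemma measurable_data_Mmx j k :
  measurable_fun setT (fun e : data =>
    Mmx e.1 (fun i => to_circle (e.2 i)) j k).
Proof.
rewrite [X in measurable_fun _ X](_ : _ =
    fun e : data => if j == (e.1 : 'S_N) k then to_circle (e.2 j) else 0);
      last first.
  by apply/funext => e; rewrite mxE.
have mb : measurable_fun setT (fun e : data => j == (e.1 : 'S_N) k).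
  apply: (measurable_fun_bool true); rewrite setTI.
  exact: (measurable_data_perm [set s : 'S_N | (j == s k) = true]).
apply: measurable_fun_ifT => //.
exact: (measurableT_comp measurable_to_circle (measurable_data_entry j)).
Qed.

Lemma measurable_eigenangles : exists y : 'I_N -> data -> R,
  (forall i, measurable_fun setT (y i)) /\
  forall e, char_poly (Mmx e.1 (fun i => to_circle (e.2 i))) =
    \prod_(i < N) ('X - (circle_param (y i e))%:P).
Proof.
apply: measurable_circle_roots.
- exact: (measurable_coefs_char_poly measurable_data_Mmx).
- by move=> e; exact: char_poly_monic.
- by move=> e; rewrite size_char_poly.
- by move=> e a; apply: Mmx_root_norm => j; exact: to_circle_norm.
Qed.

End matrix_data.

Section finite_N.
Variables (R : realType) (N : nat) (theta : R).
Context d (T : measurableType d) (P : probability T R).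
Variables (sigma : {RV P >-> 'S_N}) (z : 'I_N -> {RV P >-> R[i]}).
Hypothesis Mdata : Mmx_data theta (uniform_circle R) sigma z.
Local Notation data := (g_sigma_algebraType (@rectangles R N)).

Definition rotated_data (t : R) (w : T) : data :=
  (sigma w, fun j => circle_param t * z j w).

Lemma measurable_sigma (S : set 'S_N) : measurable (sigma @^-1` S).
Proof. by rewrite -[X in measurable X]setTI; apply: measurable_funP. Qed.

Lemma measurable_rotated_data t : measurable_fun setT (rotated_data t).
Proof.
apply: measurable_to_data; first exact: measurable_sigma.
by move=> j; apply: measurable_complexM => //; exact: measurable_cst.
Qed.

(** Independence indexed by option 'I_N, where None stands for the
    permutation. *)
Lemma rectangle_probability (S : set 'S_N) (B : 'I_N -> set R[i]) :
  (forall j, measurable (B j)) ->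
  P (rotated_data 0 @^-1` rectangle S B) =
  (\prod_(i <- [fset i in enum {: option 'I_N}]%fset)
     oapp (fun j => uniform_circle R (B j)) (P (sigma @^-1` S)) i)%E.
Proof.
move=> mB; have [_ lawz indep] := Mdata.
pose F i := oapp (fun j => z j @^-1` B j) (sigma @^-1` S) i.
transitivity (\prod_(i <- [fset i in enum {: option 'I_N}]%fset) P (F i))%E;
  last first.
  by apply: eq_bigr => -[j|] _ //=; exact: lawz.
rewrite -indep; last first.
  move=> [j|] _; rewrite /F/=.
    by exists (B j) => //; rewrite setTI.
  by exists S => //; rewrite setTI.
congr (P _); apply/seteqP; split => w; rewrite /rectangle/=.
  move=> [Sw Bw] [j|] _ //=; have := Bw j.
  by rewrite circle_param0 mul1r.
move=> H; split; first by apply: (H None); rewrite /= !inE mem_enum.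
by move=> j; rewrite circle_param0 mul1r; apply: (H (Some j));
  rewrite /= !inE mem_enum.
Qed.

(** Multiplying by e(t) moves each factor of a rectangle by a rotation, which
    [uniform_circle_rotation] allows; rectangles determine the law. *)
Lemma rotated_data_law t (A : set data) : measurable A ->
  P (rotated_data t @^-1` A) = P (rotated_data 0 @^-1` A).
Proof.
pose m s := pushforward_measure P (measurable_rotated_data s).
move=> mA.
apply: (@measure_unique _ R data (@rectangles R N) (fun=> setT) _ _ _ _ (m t)
  (m 0)) => //.
- exact: rectangles_setI.
- by move=> _; exact: rectangles_setT.
- by apply/seteqP; split => // e _; exists 0%N.
- move=> _ [S [B [mB ->]]].
  have mtB j : measurable ((fun c => circle_param t * c) @^-1` B j).
    rewrite -[X in measurable X]setTI.
    apply: measurable_complexM => //; exact: measurable_cst.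
  transitivity (P (rotated_data 0 @^-1` rectangle S
    (fun j => (fun c => circle_param t * c) @^-1` B j))).
    congr (P _); apply/seteqP; split => w; rewrite /rectangle/=.
      by move=> [Sw H]; split => // j; rewrite circle_param0 mul1r.
    by move=> [Sw H]; split => // j; have := H j; rewrite circle_param0 mul1r.
  transitivity (P (rotated_data 0 @^-1` rectangle S B)); last by [].
  rewrite !rectangle_probability//.
  by apply: eq_bigr => -[j|] _ //=; exact: uniform_circle_rotation.
- by move=> _; rewrite /m/= /pushforward preimage_setT (@le_lt_trans _ _ 1%E)//
    ?ltry// probability_le1.
Qed.
End finite_N.

(** * Intensity for finite N *)

Lemma measurable_off_circle (R : realType) :
  measurable [set c : R[i] | `|c| != 1].
Proof.
rewrite (_ : [set _ | _] = ~` [set c | `|c| == 1]); last first.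
  by apply/seteqP; split => c /=; move/negP.
by apply: measurableC; exact: measurable_unit_circle.
Qed.

Section finite_N_average.
Variables (R : realType) (N : nat) (theta : R).
Hypothesis N_gt0 : (0 < N)%N.
Context d (T : measurableType d) (P : probability T R).
Variables (sigma : {RV P >-> 'S_N}) (z : 'I_N -> {RV P >-> R[i]}).
Hypothesis Mdata : Mmx_data theta (uniform_circle R) sigma z.
Local Notation data := (g_sigma_algebraType (@rectangles R N)).

Lemma entries_on_circle : {ae P, forall w, forall j, `|z j w| = 1}.
Proof.
have [_ lawz _] := Mdata.
apply: filter_forall => j; exists (z j @^-1` [set c | `|c| != 1]); split.
- by rewrite -[X in measurable X]setTI; apply: measurable_funP => //;
    exact: measurable_off_circle.
- by rewrite -[RHS](uniform_circle_norm R); apply: lawz;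
    exact: measurable_off_circle.
- by move=> w /= /eqP.
Qed.

Lemma sum_grid_count_average (A : set R) (b : 'I_N -> R) : measurable A ->
  (\int[uniform_prob (@ltr01 R)]_t \sum_(i < N) grid_count N%:R^-1 (t + b i) A =
   lebesgue_measure A)%E.
Proof.
move=> mA.
have N0 : 0 < N%:R^-1 :> R by rewrite invr_gt0 ltr0n.
have mg i : measurable_fun setT
  (fun t : measurableTypeR R => grid_count N%:R^-1 (t + b i) A).
  by apply: measurable_grid_count => //; exact: measurable_funD.
rewrite integral_uniform/=; last 2 first.
- exact: emeasurable_sum.
- by move=> t; apply: sume_ge0 => i _; exact: grid_count_ge0.
rewrite subr0 invr1 mul1e ge0_integral_sum//; last 2 first.
- by move=> i; apply: measurable_funTS; exact: mg.
- by move=> i t _; exact: grid_count_ge0.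
under eq_bigr do rewrite integral_grid_count//.
rewrite -ge0_sume_distrl; last by move=> i _; rewrite lee_fin ltW.
by rewrite sumEFin sumr_const card_ord -[X in X%:E]mulr_natl mulfV ?mul1e//
  pnatr_eq0 -lt0n.
Qed.

(** The measure tau_N of A is only known to agree almost surely with a
    measurable function of the data, whence [ge0_integral_ae_eq_measurable]. *)
Lemma correlation1_tauN (A : set R) : measurable A ->
  correlation1 P (fun w => tauN (Mmx (sigma w) (fun j => z j w))) A =
  lebesgue_measure A.
Proof.
move=> mA; rewrite /correlation1.
have [y [my yE]] := @measurable_eigenangles R N.
(* The count for the data moved to the circle, where angles are available. *)
pose F (e : data) := (\sum_(i < N) grid_count N%:R^-1 (y i e) A)%E.
have mF : measurable_fun setT F.
  by apply: emeasurable_sum => i; exact: measurable_grid_count.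
have F0 e : (0 <= F e)%E by apply: sume_ge0 => i _; exact: grid_count_ge0.
pose X t w : data := rotated_data sigma z t w.
have mX t : measurable_fun setT (X t) by exact: measurable_rotated_data.
(* The count after a rotation of all eigenangles by the second variable. *)
pose K (u : T * measurableTypeR R) :=
  (\sum_(i < N) grid_count N%:R^-1 (u.2 + y i (X 0 u.1))%R A)%E.
have mK : measurable_fun setT K.
  apply: emeasurable_sum => i; apply: measurable_grid_count => //.
  apply: measurable_funD => //.
  exact: (measurableT_comp (my i) (measurableT_comp (mX 0) measurable_fst)).
have K0 u : (0 <= K u)%E by apply: sume_ge0 => i _; exact: grid_count_ge0.
(* Rotating the entries rotates the eigenangles; the angles chosen for the
   rotated matrix may differ from these, but they give the same count. *)
have FX t w : (forall j, `|z j w| = 1) -> F (X t w) = K (w, t).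
  move=> zw.
  have E (s : R) : (fun j => to_circle ((X s w).2 j)) =
    (fun j => circle_param s * z j w).
    apply/funext => j; rewrite /X/= to_circle_id//.
    by rewrite normrM circle_param_norm zw mul1r.
  rewrite /F /K/= -(tauN_grid_count A N_gt0 (yE (X t w))).
  rewrite -(tauN_grid_count A N_gt0 (y := fun i => t + y i (X 0 w))
    (M := Mmx (X t w).1 (fun i => to_circle ((X t w).2 i))))//.
  rewrite (E t) Mmx_scale.
  under [RHS]eq_bigr do rewrite circle_paramD.
  apply: char_poly_scale; first exact: circle_param_neq0.
  rewrite -(yE (X 0 w)); congr (char_poly (Mmx _ _)).
  by rewrite [RHS](E 0); apply/funext => j; rewrite circle_param0 mul1r.
(* The mean count, which by invariance of the law ignores the rotation. *)
pose I := (\int[P]_w F (X 0%R w))%E.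
have IX t : (\int[P]_w K (w, t) = I)%E.
  transitivity (\int[P]_w F (X t w))%E.
    apply: ge0_ae_eq_integral => //.
    - have mt : measurable_fun setT (fun w => (w, t) : T * measurableTypeR R).
        by apply/measurable_fun_pairP; split;
          [exact: measurable_id|exact: measurable_cst].
      exact: (measurableT_comp mK mt).
    - exact: (measurableT_comp mF (mX t)).
    - by apply: filterS entries_on_circle => w zw _; exact/esym/FX.
  rewrite /I -[LHS](ge0_integral_pushforward (mX t) P measurableT mF
    (fun e _ => F0 e)).
  rewrite -[RHS](ge0_integral_pushforward (mX 0) P measurableT mF
    (fun e _ => F0 e)).
  apply: (eq_measure_integral (pushforward_measure P (mX 0))
     (m1 := (pushforward_measure P (mX t)))).
  by move=> B mB _; exact: (rotated_data_law Mdata).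
transitivity I.
  apply: ge0_integral_ae_eq_measurable => //.
  - by move=> w; apply: esum_ge0 => x _; rewrite mule_ge0.
  - exact: (measurableT_comp mF (mX 0)).
  - apply: filterS entries_on_circle => w zw.
    apply: (etrans _ (tauN_grid_count A N_gt0 (yE (X 0 w)))).
    have e : (fun j => z j w) = (fun j => to_circle ((X 0 w).2 j)).
      by apply/funext => j; rewrite /X/= circle_param0 mul1r to_circle_id.
    exact: (congr1 (fun v => tauN (Mmx (sigma w) v) A) e).
transitivity (\int[uniform_prob (@ltr01 R)]_t \int[P]_w K (w, t))%E.
  under eq_integral do rewrite IX.
  by rewrite integral_cst//
    [X in (_ * X)%E](probability_setT (uniform_prob (@ltr01 R))) mule1.
rewrite -fubini_tonelli//.
transitivity (\int[P]_w (cst (lebesgue_measure A) w))%E.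
  by apply: eq_integral => w _;
    exact: (sum_grid_count_average (fun i => y i (X 0 w)) mA).
by rewrite integral_cst// [X in (_ * X)%E](probability_setT P) mule1.
Qed.

End finite_N_average.

Theorem proposition5p5 (R : realType) (theta : R) (theta_gt0 : 0 < theta) :
  (forall (N : nat) (N_gt0 : (0 < N)%N)
     (d : measure_display) (T : measurableType d) (P : probability T R)
     (sigma : {RV P >-> 'S_N}) (z : 'I_N -> {RV P >-> R[i]}),
     Mmx_data theta (uniform_circle R) sigma z ->
     forall A : set R, measurable A ->
       correlation1 P (fun w => tauN (Mmx (sigma w) (fun j => z j w))) A =
       lebesgue_measure A) /\
  (forall (d : measure_display) (T : measurableType d) (P : probability T R)
     (x : {RV P >-> realseq R}) (chi : nat -> {RV P >-> R}),
     tau_infty_data theta x chi ->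
     forall A : set R, measurable A ->
       correlation1 P (fun w => tau_infty (x w) (fun m => chi m w)) A =
       lebesgue_measure A).
Proof.
split=> [N N_gt0 d T P sigma z Mdata A mA|d T P x chi data A mA].
- exact: (correlation1_tauN N_gt0 Mdata mA).
- exact: (correlation1_tau_infty data mA).
Qed.
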